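(* Let $L$ be a Leibniz algebra of finite dimension $n$ over a field $F$. Then there exists a faithful $L$-module $V$ (that is, $\{x\in L \mid \lambda_x=\rho_x=0\}=0$) with $\dim V \le n+1$ and with the following additional properties: (1) The left action $\lambda_x$ of $x$ on $V$ is nilpotent for every $x\in L$ whose left action $d_x: L\to L$, $d_x(y)=xy$, is nilpotent. (2) The right action $\rho_x$ of $x$ on $V$ is nilpotent for every $x\in L$ whose right action $r_x: L\to L$, $r_x(y)=yx$, is nilpotent. (3) $V$ is $(U,\mathfrak F)$-hypercentral for every saturated formation $\mathfrak F$ of soluble Leibniz algebras (over $F$) and every subnormal subalgebra $U$ of $L$ with $U\in\mathfrak F$.
   Context: Leibniz algebras are left Leibniz algebras: a (left) Leibniz algebra over a field $F$ is a vector space $L$ with a bilinear product such that every left multiplication $d_a: x\mapsto ax$ is a derivation, i.e. $a(xy)=(ax)y+x(ay)$. An ideal is a two-sided ideal; for subspaces, $AB$ denotes the span of the products. An $L$-module is a vector space $V$ with two bilinear compositions $xv, vx\in V$ ($x\in L$, $v\in V$) satisfying $x(yv)=(xy)v+y(xv)$, $x(vy)=(xv)y+v(xy)$, $v(xy)=(vx)y+x(vy)$ for all $x,y\in L$, $v\in V$. Write $\lambda_x: v\mapsto xv$ and $\rho_x: v\mapsto vx$. The kernel of $V$ in $L$ is $\ker(V)=\{x\in L\mid \lambda_x=\rho_x=0\}$. The split extension of $V$ by $L$ is the Leibniz algebra $L\oplus V$ with product $(x+v)(y+w)=xy+xw+vy$. A subalgebra $U$ of $L$ is subnormal if there is a chain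 of subalgebras $U=U_0\subseteq U_1\subseteq\dots\subseteq U_m=L$ with each $U_{i-1}$ an ideal of $U_i$. $L$ is soluble if its derived series ($L^{(0)}=L$, $L^{(i+1)}=L^{(i)}L^{(i)}$) reaches $0$. A formation of soluble Leibniz algebras over $F$ is a class $\mathfrak F$ of finite-dimensional soluble Leibniz algebras over $F$, closed under isomorphism and quotients, such that if $A,B$ are ideals of $K$ with $K/A, K/B\in\mathfrak F$, then $K/(A\cap B)\in\mathfrak F$. It is saturated if, whenever $K$ is a finite-dimensional soluble Leibniz algebra and $A$ is an ideal of $K$ contained in the intersection of all maximal subalgebras of $K$ with $K/A\in\mathfrak F$, then $K\in\mathfrak F$. For a Leibniz algebra $U$, an irreducible $U$-module $W$ is $(U,\mathfrak F)$-central if the split extension of $W$ by $U/\ker_U(W)$ is in $\mathfrak F$, where $\ker_U(W)$ is the kernel of $W$ in $U$. A finite-dimensional $U$-module is $(U,\mathfrak F)$-hypercentral if all its composition factors as a $U$-module are $(U,\mathfrak F)$-central. When $U$ is a subalgebra of $L$, an $L$-module is called $(U,\mathfrak F)$-hypercentral if it is so when regarded as a $U$-module.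
   Formalization: Property (3) is stated only for saturated formations containing a nonzero algebra; it fails for the saturated formation of zero algebras (take U = 0 and L nonzero: composition factors of V are one-dimensional and their split extensions are not zero). *)

(* Defs.v *)
From HB Require Import structures.
From mathcomp Require Import all_boot all_order all_algebra.

Set Implicit Arguments.
Unset Strict Implicit.
Unset Printing Implicit Defensive.

Import GRing.Theory.
Local Open Scope ring_scope.

Reserved Notation "x ** y" (at level 40, left associativity).
Reserved Notation "x *> v" (at level 40, left associativity).
Reserved Notation "v <* x" (at level 40, left associativity).

Definition nilpotent_map (F : fieldType) (V : vectType F) (f : V -> V) : Prop :=
  exists k : nat, forall v, iter k f v = 0.

(* The quotient space V / A is carried by the chosen complement A^C; vquo is  *)
(* the canonical projection (whose kernel is A, see vquo_eq0) and vrepr picks *)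
(* representatives.                                                           *)
Section QuotientSpace.
Variables (F : fieldType) (V : vectType F) (A : {vspace V}).

Definition quotv : vectType F := subvs_of (A^C)%VS.

Definition vquo (v : V) : quotv := vsproj (A^C)%VS (daddv_pi (A^C)%VS A v).
Definition vrepr (w : quotv) : V := vsval w.

Lemma vquo_is_linear : linear vquo.
Proof. by move=> a u v; rewrite /vquo !linearP. Qed.
HB.instance Definition _ := GRing.isSemilinear.Build F V quotv _ vquo
  (GRing.semilinear_linear vquo_is_linear).

Lemma vrepr_is_linear : linear vrepr.
Proof. by move=> a u v; rewrite /vrepr !linearP. Qed.
HB.instance Definition _ := GRing.isSemilinear.Build F quotv V _ vrepr
  (GRing.semilinear_linear vrepr_is_linear).

Lemma vreprK : cancel vrepr vquo.
Proof.
move=> w; rewrite /vquo /vrepr daddv_pi_id ?subvsP ?vsvalK //.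
by rewrite capvC capv_compl.
Qed.

Lemma vquoK_mem v : vrepr (vquo v) - v \in A.
Proof.
have dAC : (A^C :&: A = 0)%VS by rewrite capvC capv_compl.
have sAC : (v \in A^C + A)%VS by rewrite addvC addv_complf memvf.
rewrite /vrepr /vquo vsprojK ?memv_pi //.
by rewrite -{2}(daddv_pi_add dAC sAC) opprD addrA subrr sub0r rpredN memv_pi.
Qed.

Lemma vquo_eq0 v : (vquo v == 0) = (v \in A).
Proof.
apply/eqP/idP => [v0 | Av]; first by
  have := vquoK_mem v; rewrite v0 linear0 sub0r rpredN.
apply/val_inj/eqP; rewrite /= -memv0 -(capv_compl A) memv_cap.
rewrite [val _ \in (A^C)%VS]subvsP andbT.
by rewrite -(subrK v (val _)) rpredD ?vquoK_mem.
Qed.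

Lemma vquo_eq u v : (vquo u == vquo v) = (u - v \in A).
Proof. by rewrite -subr_eq0 -linearB vquo_eq0. Qed.

Lemma vquo_eqP u v : u - v \in A -> vquo u = vquo v.
Proof. by rewrite -vquo_eq => /eqP. Qed.

End QuotientSpace.

Arguments vquo {F V} A v.
Arguments vrepr {F V A} w.

(* Finite-dimensional left Leibniz algebras. *)
HB.mixin Record isLeibniz (F : fieldType) L of Vector F L := {
  lbmul : L -> L -> L;
  lbmul_bilinear : bilinear_for *:%R *:%R lbmul;
  lbmulA : forall a x y, lbmul a (lbmul x y)
                         = lbmul (lbmul a x) y + lbmul x (lbmul a y)
}.

#[short(type="leibnizType")]
HB.structure Definition Leibniz (F : fieldType) :=
  {L of isLeibniz F L & Vector F L}.

Notation "x ** y" := (lbmul x y) : ring_scope.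

Section LeibnizTheory.
Variables (F : fieldType) (L : leibnizType F).
Implicit Types (x y : L) (A B C : {vspace L}).

HB.instance Definition _ :=
  bilinear_isBilinear.Build F L L L *:%R *:%R (@lbmul F L) lbmul_bilinear.

Lemma lbmulBl x x' y : (x - x') ** y = x ** y - x' ** y.
Proof. exact: linearBl. Qed.
Lemma lbmulBr x y y' : x ** (y - y') = x ** y - x ** y'.
Proof. exact: linearBr. Qed.

(* The span of all products. *)
Definition lprod A B : {vspace L} :=
  <<[seq x ** y | x <- vbasis A, y <- vbasis B]>>%VS.

Lemma memv_lprod A B x y : x \in A -> y \in B -> x ** y \in lprod A B.
Proof.
move/coord_vbasis=> -> /coord_vbasis=> ->.
rewrite linear_sumlz; apply: memv_suml => i _ /=.
rewrite linear_sumr; apply: memv_suml => j _ /=.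
rewrite linearZl_LR linearZr /= !memvZ // memv_span //.
by apply/allpairsP; exists ((vbasis A)`_i, (vbasis B)`_j);
   rewrite !memt_nth.
Qed.

Lemma lprodP A B C :
  reflect (forall x y, x \in A -> y \in B -> x ** y \in C)
          (lprod A B <= C)%VS.
Proof.
apply: (iffP idP) => [/subvP sABC x y Ax By | sABC].
  exact/sABC/memv_lprod.
apply/span_subvP=> _ /allpairsP[[u v] /= [Uu Vv ->]].
by apply: sABC; apply: vbasis_mem.
Qed.

Definition is_subalgebra A : Prop :=
  forall x y, x \in A -> y \in A -> x ** y \in A.

Definition is_ideal_of A B : Prop :=
  (A <= B)%VS /\
  forall x a, x \in B -> a \in A -> (x ** a \in A) /\ (a ** x \in A).

Record subalgebra := Subalgebra {
  subalg_space :> {vspace L};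
  subalgP : is_subalgebra subalg_space }.

Record ideal := Ideal {
  ideal_space :> {vspace L};
  idealP : is_ideal_of ideal_space fullv }.

Lemma ideal_mull (A : ideal) x a : a \in A -> x ** a \in A.
Proof. by have [_ idA] := idealP A; case/(idA x a (memvf x)). Qed.
Lemma ideal_mulr (A : ideal) x a : a \in A -> a ** x \in A.
Proof. by have [_ idA] := idealP A; case/(idA x a (memvf x)). Qed.

Lemma capi_subproof (A B : ideal) : is_ideal_of (A :&: B)%VS fullv.
Proof.
split=> [|x a _]; rewrite ?subvf // !memv_cap => /andP[Aa Ba].
split; apply/andP; split;
   first [exact: ideal_mull | exact: ideal_mulr].
Qed.
Definition capi (A B : ideal) : ideal := Ideal (capi_subproof A B).

Definition subnormal (U : {vspace L}) : Prop :=
  exists (m : nat) (C : nat -> {vspace L}),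
    [/\ C 0 = U, C m = fullv,
        forall i, i <= m -> is_subalgebra (C i)
      & forall i, i < m -> is_ideal_of (C i) (C i.+1)]%N.

Definition maximal_subalgebra (M : {vspace L}) : Prop :=
  [/\ is_subalgebra M, M <> fullv
    & forall S : {vspace L}, is_subalgebra S -> (M <= S)%VS ->
        S = M \/ S = fullv].

Fixpoint derived_series (i : nat) : {vspace L} :=
  if i is j.+1 then lprod (derived_series j) (derived_series j) else fullv.

Definition soluble : Prop := exists i, derived_series i = 0%VS.

End LeibnizTheory.

Arguments soluble {F} L.

Definition isomorphic (F : fieldType) (L L' : leibnizType F) : Prop :=
  exists f : {linear L -> L'},
    bijective f /\ forall x y : L, f (x ** y) = f x ** f y.

Section SubAlgebra.
Variables (F : fieldType) (L : leibnizType F) (U : subalgebra L).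

Definition subalg_of : Type := subvs_of U.
HB.instance Definition _ := Vector.on subalg_of.

Definition subalg_mul (x y : subalg_of) : subalg_of :=
  Subvs (subalgP (subvsP x) (subvsP y)).

Lemma subalg_mul_bilinear : bilinear_for *:%R *:%R subalg_mul.
Proof.
by split=> [y a x x' | x a y y']; apply: val_inj;
   rewrite /= ?linearPl ?linearPr.
Qed.

Lemma subalg_mulA a x y :
  subalg_mul a (subalg_mul x y)
  = subalg_mul (subalg_mul a x) y + subalg_mul x (subalg_mul a y).
Proof. exact/val_inj/lbmulA. Qed.

HB.instance Definition _ :=
  isLeibniz.Build F subalg_of subalg_mul_bilinear subalg_mulA.

End SubAlgebra.

Section QuotientAlgebra.
Variables (F : fieldType) (L : leibnizType F) (A : ideal L).

Definition quot_mul (x y : quotv A) : quotv A :=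
  vquo A (vrepr x ** vrepr y).

Lemma vquo_mul (x y : L) :
  quot_mul (vquo A x) (vquo A y) = vquo A (x ** y).
Proof.
apply: vquo_eqP.
rewrite -(subrK (vrepr (vquo A x) ** y) (_ ** vrepr _)) -addrA -lbmulBr -lbmulBl.
by apply: rpredD; [apply: ideal_mull | apply: ideal_mulr]; apply: vquoK_mem.
Qed.

Lemma quot_mul_bilinear : bilinear_for *:%R *:%R quot_mul.
Proof.
by split=> [y a x x' | x a y y'];
   rewrite /quot_mul (linearP vrepr) (linearPl, linearPr) (linearP (vquo A)).
Qed.

Lemma quot_mulA a x y :
  quot_mul a (quot_mul x y)
  = quot_mul (quot_mul a x) y + quot_mul x (quot_mul a y).
Proof.
rewrite -[a]vreprK -[x]vreprK -[y]vreprK !vquo_mul lbmulA.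
exact: (linearD (vquo A)).
Qed.

Definition quot_alg : Type := quotv A.
HB.instance Definition _ := Vector.on quot_alg.
HB.instance Definition _ :=
  isLeibniz.Build F quot_alg quot_mul_bilinear quot_mulA.

End QuotientAlgebra.

(* A plain record rather than a structure inferred from the carrier, since    *)
(* one space is used as a module over several algebras below.                 *)
Record lbmodule (F : fieldType) (L : leibnizType F) := LbModule {
  lbmod_space :> vectType F;
  lact : L -> lbmod_space -> lbmod_space;
  ract : lbmod_space -> L -> lbmod_space;
  lact_bilinear : bilinear_for *:%R *:%R lact;
  ract_bilinear : bilinear_for *:%R *:%R ract;
  lactA : forall x y v, lact x (lact y v) = lact (x ** y) v + lact y (lact x v);
  lractA : forall x v y,
    lact x (ract v y) = ract (lact x v) y + ract v (x ** y);
  ractA : forall v x y,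
    ract v (x ** y) = ract (ract v x) y + lact x (ract v y) }.

Arguments lact {F L l} x v : rename.
Arguments ract {F L l} v x : rename.
Notation "x *> v" := (lact x v) : ring_scope.
Notation "v <* x" := (ract v x) : ring_scope.

Section ModuleTheory.
Variables (F : fieldType) (L : leibnizType F) (V : lbmodule L).

HB.instance Definition _ := bilinear_isBilinear.Build F L V V *:%R *:%R
  (@lact F L V) (lact_bilinear V).
HB.instance Definition _ := bilinear_isBilinear.Build F V L V *:%R *:%R
  (@ract F L V) (ract_bilinear V).

Definition is_submodule (W : {vspace V}) : Prop :=
  forall (x : L) (v : V), v \in W -> (x *> v \in W) /\ (v <* x \in W).

Record submodule := Submodule {
  submod_space :> {vspace V};
  submodP : is_submodule submod_space }.

Lemma submod_lact (W : submodule) x v : v \in W -> x *> v \in W.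
Proof. by move=> Wv; have [] := submodP x Wv. Qed.
Lemma submod_ract (W : submodule) x v : v \in W -> v <* x \in W.
Proof. by move=> Wv; have [] := submodP x Wv. Qed.

Definition irreducible : Prop :=
  {:V}%VS <> 0%VS /\
  forall W : submodule, W = 0%VS :> {vspace V} \/ W = fullv :> {vspace V}.

Definition lambda (x : L) : 'End(V) := linfun (fun v : V => x *> v).
Definition rho (x : L) : 'End(V) := linfun (fun v : V => v <* x).

Definition modker : {vspace L} :=
  (lker (linfun lambda) :&: lker (linfun rho))%VS.

Lemma lambdaE x v : lambda x v = x *> v.
Proof.
pose f : {bilinear L -> V -> V | *:%R & *:%R} := @lact F L V.
exact: (lfunE (f x)).
Qed.
Lemma rhoE x v : rho x v = v <* x.
Proof.
pose f : {bilinear V -> L -> V | *:%R & *:%R} := @ract F L V.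
exact: (lfunE (applyr f x)).
Qed.

Lemma lambda_is_linear : linear lambda.
Proof.
move=> a x y; apply/lfunP=> v.
by rewrite add_lfunE scale_lfunE !lambdaE linearPl.
Qed.
HB.instance Definition _ := GRing.isSemilinear.Build F L 'End(V) _ lambda
  (GRing.semilinear_linear lambda_is_linear).
Lemma rho_is_linear : linear rho.
Proof.
move=> a x y; apply/lfunP=> v.
by rewrite add_lfunE scale_lfunE !rhoE linearPr.
Qed.
HB.instance Definition _ := GRing.isSemilinear.Build F L 'End(V) _ rho
  (GRing.semilinear_linear rho_is_linear).

Lemma modkerP x :
  reflect (forall v : V, x *> v = 0 /\ v <* x = 0) (x \in modker).
Proof.
rewrite memv_cap !memv_ker !lfunE /=.
apply: (iffP andP) => [[/eqP l0 /eqP r0] v | x0].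
  by rewrite -lambdaE -rhoE l0 r0 !zero_lfunE.
by split; apply/eqP/lfunP=> v; have [? ?] := x0 v;
   rewrite ?lambdaE ?rhoE zero_lfunE.
Qed.

Lemma modker_subproof : is_ideal_of modker fullv.
Proof.
split=> [|x a _ /modkerP a0]; first exact: subvf.
have l0 (v : V) : a *> v = 0 by case: (a0 v).
have r0 (v : V) : v <* a = 0 by case: (a0 v).
split; apply/modkerP=> v; split.
- have := lactA x a v; rewrite !l0 addr0 linear0r.
  by move/esym.
- have := lractA x v a; rewrite !r0 add0r linear0r.
  by move/esym.
- have := lactA a x v; rewrite !l0 linear0r addr0.
  by move/esym.
- by rewrite ractA r0 l0 linear0l addr0.
Qed.
Definition modker_ideal : ideal L := Ideal modker_subproof.

End ModuleTheory.

Section Modules.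
Variables (F : fieldType) (L : leibnizType F).

Section SubModule.
Variables (V : lbmodule L) (W : submodule V).

Definition submod_lact_op (x : L) (w : subvs_of W) : subvs_of W :=
  Subvs (submod_lact x (subvsP w)).
Definition submod_ract_op (w : subvs_of W) (x : L) : subvs_of W :=
  Subvs (submod_ract x (subvsP w)).

Lemma submod_lact_bilinear : bilinear_for *:%R *:%R submod_lact_op.
Proof.
by split=> [? ? ? ? | ? ? ? ?]; apply: val_inj;
   rewrite /= ?linearPl ?linearPr.
Qed.
Lemma submod_ract_bilinear : bilinear_for *:%R *:%R submod_ract_op.
Proof.
by split=> [? ? ? ? | ? ? ? ?]; apply: val_inj;
   rewrite /= ?linearPl ?linearPr.
Qed.

Lemma submod_lactA x y w :
  submod_lact_op x (submod_lact_op y w)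
  = submod_lact_op (x ** y) w + submod_lact_op y (submod_lact_op x w).
Proof. exact/val_inj/lactA. Qed.
Lemma submod_lractA x w y :
  submod_lact_op x (submod_ract_op w y)
  = submod_ract_op (submod_lact_op x w) y + submod_ract_op w (x ** y).
Proof. exact/val_inj/lractA. Qed.
Lemma submod_ractA w x y :
  submod_ract_op w (x ** y)
  = submod_ract_op (submod_ract_op w x) y
    + submod_lact_op x (submod_ract_op w y).
Proof. exact/val_inj/ractA. Qed.

Definition sub_module : lbmodule L :=
  @LbModule F L (subvs_of W) submod_lact_op submod_ract_op
    submod_lact_bilinear submod_ract_bilinear
    submod_lactA submod_lractA submod_ractA.

Lemma preim_submodule_subproof (T : submodule V) :
  @is_submodule F L sub_module (linfun (vsval : subvs_of W -> V) @^-1: T)%VS.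
Proof.
move=> x v; rewrite -!memv_preim !lfunE /= => Tv.
by split; [apply: submod_lact | apply: submod_ract].
Qed.
(* T as a submodule of W (that is, T :&: W in general). *)
Definition preim_submodule (T : submodule V) : submodule sub_module :=
  Submodule (@preim_submodule_subproof T).

End SubModule.

Section QuotientModule.
Variables (V : lbmodule L) (T : submodule V).

Definition quot_lact (x : L) (w : quotv T) : quotv T := vquo T (x *> vrepr w).
Definition quot_ract (w : quotv T) (x : L) : quotv T := vquo T (vrepr w <* x).

Lemma quot_lactE x v : quot_lact x (vquo T v) = vquo T (x *> v).
Proof. by apply: vquo_eqP; rewrite -linearBr submod_lact ?vquoK_mem. Qed.
Lemma quot_ractE v x : quot_ract (vquo T v) x = vquo T (v <* x).
Proof. by apply: vquo_eqP; rewrite -linearBl submod_ract ?vquoK_mem. Qed.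

Lemma quot_lact_bilinear : bilinear_for *:%R *:%R quot_lact.
Proof.
by split=> [w a x y | x a w z]; rewrite /quot_lact ?linearP ?linearPl ?linearPr
  ?linearP.
Qed.
Lemma quot_ract_bilinear : bilinear_for *:%R *:%R quot_ract.
Proof.
by split=> [x a w z | w a x y]; rewrite /quot_ract ?linearP ?linearPl ?linearPr
  ?linearP.
Qed.

Lemma quot_lactA x y w :
  quot_lact x (quot_lact y w) = quot_lact (x ** y) w + quot_lact y (quot_lact x w).
Proof. by rewrite -[w]vreprK !quot_lactE lactA linearD. Qed.
Lemma quot_lractA x w y :
  quot_lact x (quot_ract w y) = quot_ract (quot_lact x w) y + quot_ract w (x ** y).
Proof.
by rewrite -[w]vreprK !(quot_lactE, quot_ractE) lractA linearD.
Qed.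
Lemma quot_ractA w x y :
  quot_ract w (x ** y) = quot_ract (quot_ract w x) y + quot_lact x (quot_ract w y).
Proof.
by rewrite -[w]vreprK !(quot_lactE, quot_ractE) ractA linearD.
Qed.

Definition quot_module : lbmodule L :=
  @LbModule F L (quotv T) quot_lact quot_ract
    quot_lact_bilinear quot_ract_bilinear quot_lactA quot_lractA quot_ractA.

End QuotientModule.

(* The factor S / T (meaningful when T <= S). *)
Definition factor_module (V : lbmodule L) (S T : submodule V) : lbmodule L :=
  quot_module (preim_submodule S T).

Definition composition_series (V : lbmodule L) (m : nat)
    (C : nat -> submodule V) : Prop :=
  [/\ C 0%N = 0%VS :> {vspace V}, C m = fullv :> {vspace V}
    & forall i, (i < m)%N ->
        (C i <= C i.+1)%VS /\ irreducible (factor_module (C i.+1) (C i))].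

Definition composition_factor (V W : lbmodule L) : Prop :=
  exists m C i, [/\ @composition_series V m C, (i < m)%N
                  & W = factor_module (C i.+1) (C i)].

Section RestrictedModule.
Variables (U : subalgebra L) (V : lbmodule L).

Definition res_lact (x : subalg_of U) (v : V) : V := vsval x *> v.
Definition res_ract (v : V) (x : subalg_of U) : V := v <* vsval x.

Lemma res_lact_bilinear : bilinear_for *:%R *:%R res_lact.
Proof.
by split=> [? ? ? ? | ? ? ? ?]; rewrite /res_lact /= ?linearPl ?linearPr.
Qed.
Lemma res_ract_bilinear : bilinear_for *:%R *:%R res_ract.
Proof.
by split=> [? ? ? ? | ? ? ? ?]; rewrite /res_ract /= ?linearPl ?linearPr.
Qed.

Definition res_module : lbmodule (subalg_of U) :=
  @LbModule F (subalg_of U) V res_lact res_ract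
    res_lact_bilinear res_ract_bilinear
    (fun x y v => lactA (vsval x) (vsval y) v)
    (fun x v y => lractA (vsval x) v (vsval y))
    (fun v x y => ractA v (vsval x) (vsval y)).

End RestrictedModule.

Section ModuleModKernel.
Variable V : lbmodule L.
Let Q : leibnizType F := quot_alg (modker_ideal V).

Definition mk_lact (x : Q) (v : V) : V := vrepr x *> v.
Definition mk_ract (v : V) (x : Q) : V := v <* vrepr x.

Lemma mk_lactE (x : L) v : mk_lact (vquo (modker_ideal V) x) v = x *> v.
Proof.
apply/eqP; rewrite -subr_eq0 -linearBl; apply/eqP.
by have /modkerP/(_ v)[] := vquoK_mem (modker_ideal V) x.
Qed.
Lemma mk_ractE v (x : L) : mk_ract v (vquo (modker_ideal V) x) = v <* x.
Proof.
apply/eqP; rewrite -subr_eq0 -linearBr; apply/eqP.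
by have /modkerP/(_ v)[] := vquoK_mem (modker_ideal V) x.
Qed.

Lemma mk_lact_bilinear : bilinear_for *:%R *:%R mk_lact.
Proof.
by split=> [? ? ? ? | ? ? ? ?]; rewrite /mk_lact /= ?linearP ?linearPl ?linearPr.
Qed.
Lemma mk_ract_bilinear : bilinear_for *:%R *:%R mk_ract.
Proof.
by split=> [? ? ? ? | ? ? ? ?]; rewrite /mk_ract /= ?linearP ?linearPl ?linearPr.
Qed.

Lemma mk_lactA (x y : Q) v :
  mk_lact x (mk_lact y v) = mk_lact (x ** y) v + mk_lact y (mk_lact x v).
Proof. by rewrite [mk_lact (x ** y) v]mk_lactE; apply: lactA. Qed.
Lemma mk_lractA (x : Q) v (y : Q) :
  mk_lact x (mk_ract v y) = mk_ract (mk_lact x v) y + mk_ract v (x ** y).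
Proof. by rewrite [mk_ract v (x ** y)]mk_ractE; apply: lractA. Qed.
Lemma mk_ractA v (x y : Q) :
  mk_ract v (x ** y) = mk_ract (mk_ract v x) y + mk_lact x (mk_ract v y).
Proof. by rewrite [mk_ract v (x ** y)]mk_ractE; apply: ractA. Qed.

Definition module_mod_ker : lbmodule (quot_alg (modker_ideal V)) :=
  @LbModule F Q V mk_lact mk_ract mk_lact_bilinear mk_ract_bilinear
    mk_lactA mk_lractA mk_ractA.

End ModuleModKernel.

Section SplitExtension.
Variable V : lbmodule L.

Definition split_ext : Type := (L * V)%type.
HB.instance Definition _ := Vector.on split_ext.

Definition split_mul (p q : split_ext) : split_ext :=
  (p.1 ** q.1, p.1 *> q.2 + p.2 <* q.1).

Lemma split_mul_bilinear : bilinear_for *:%R *:%R split_mul.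
Proof.
split=> [[y w] a [x v] [x' v'] | [x v] a [y w] [y' w']];
  congr pair => /=; rewrite ?linearPl ?linearPr //= scalerDr addrACA //.
Qed.

Lemma split_mulA p q r :
  split_mul p (split_mul q r)
  = split_mul (split_mul p q) r + split_mul q (split_mul p r).
Proof.
case: p q r => [x u] [y v] [z w]; congr pair => /=; first exact: lbmulA.
rewrite !linearDr !linearDl /= lactA lractA (ractA u).
by rewrite [LHS](AC (2*2*2) ((1*(3*5))*((2*6)*4))).
Qed.

HB.instance Definition _ :=
  isLeibniz.Build F split_ext split_mul_bilinear split_mulA.

End SplitExtension.

End Modules.

Arguments composition_factor {F L} V W.

Arguments split_ext {F L} V.

Section Formations.
Variable F : fieldType.
Implicit Type FF : leibnizType F -> Prop.

Record formation FF : Prop := {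
  formation_soluble : forall K, FF K -> soluble K;
  formation_iso : forall K K', isomorphic K K' -> FF K -> FF K';
  formation_quot : forall K (A : ideal K), FF K -> FF (quot_alg A);
  formation_capi : forall K (A B : ideal K),
    FF (quot_alg A) -> FF (quot_alg B) -> FF (quot_alg (capi A B)) }.

Definition saturated FF : Prop :=
  forall (K : leibnizType F) (A : ideal K), soluble K ->
    (forall M : {vspace K}, maximal_subalgebra M -> (A <= M)%VS) ->
    FF (quot_alg A) -> FF K.

Definition central FF (U : leibnizType F) (W : lbmodule U) : Prop :=
  irreducible W /\ FF (split_ext (module_mod_ker W)).

Definition hypercentral FF (U : leibnizType F) (V : lbmodule U) : Prop :=
  forall W : lbmodule U, composition_factor V W -> central FF W.

End Formations.

(* Main.v *)
(* On V = L + F e let x(l + c e) = xl and (l + c e)x = c x: then e x = x makes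
   V faithful, and all products of right actions vanish.  Hence U acts on the
   right of a composition factor W of V as 0.  If the left action is zero too,
   W is trivial of dimension 1.  Otherwise, as U pushes V down the subnormal
   chain into U, W is a factor of U under left multiplication, and the choice
   of a suitable chief factor A/B of U identifies W, as a left module, with A/B.
   - The split extension of A/B by U is in FF, being subdirect in U x U/B
     through (u, a) |-> u and (u, a) |-> u + a.
   - If A/B has zero right action this is what we want.  Otherwise its right
     action is opposite to the left one; let M be A/B, M' the same left module
     with zero right action, and let t span a one-dimensional algebra T.  The
     algebra U + T + M + M' with the extra product m t = m' is in FF, because
     M' lies in every maximal subalgebra S: modulo M' each m and t lift to S,
     and the product of the lifts is m'.  Then M' is a chief factor of it, so
     the split extension of M' by U is in FF as well. *)

Require Import Defs.
From HB Require Import structures.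
From mathcomp Require Import all_boot all_order all_algebra.
From Stdlib Require Import Classical.
Import GRing.Theory.
Local Open Scope ring_scope.

Definition to_linear {F : fieldType} {V W : vectType F} {f : V -> W}
    (lin_f : linear f) : {linear V -> W} :=
  HB.pack f (GRing.isSemilinear.Build F V W _ f (GRing.semilinear_linear lin_f)).

Definition surj {A B : Type} (f : A -> B) : Prop := forall y, exists x, f x = y.

Lemma linear_surj_section {F : fieldType} {V W : vectType F}
    (f : {linear V -> W}) : surj f -> exists g : {linear W -> V}, cancel g f.
Proof.
move=> surj_f; exists ((linfun f)^-1)%VF => w; rewrite -[f _](lfunE f).
apply: limg_lfunVK; have [v <-] := surj_f w.
by rewrite -[f v](lfunE f) memv_img ?memvf.
Qed.

(** * Homomorphisms and closure properties of formations *)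

Section LeibnizMorphisms.
Variables (F : fieldType).
Implicit Types K L : leibnizType F.

Record is_lbhom {K L} (f : K -> L) : Prop := IsLbhom {
  lbhom_linear : linear f;
  lbhomM : forall x y, f (x ** y) = f x ** f y }.
Arguments lbhom_linear {K L f} _.

Section Kernel.
Context {K L : leibnizType F} {f : K -> L} (hf : is_lbhom f).

Lemma lbhom_ker_subproof :
  is_ideal_of (lker (linfun (to_linear (lbhom_linear hf)))) fullv.
Proof.
split=> [|x a _]; first exact: subvf.
rewrite !memv_ker !lfunE /= => /eqP fa0.
by rewrite !(lbhomM f hf) fa0 linear0r linear0l eqxx.
Qed.
Definition lbhom_ker : ideal K := Ideal lbhom_ker_subproof.

Lemma lbhom_kerE x : (x \in ideal_space lbhom_ker) = (f x == 0).
Proof. by rewrite memv_ker lfunE. Qed.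

Lemma isomorphic_bij :
  surj f -> (forall x, f x = 0 -> x = 0) -> isomorphic K L.
Proof.
move=> sf f_inj; exists (to_linear (lbhom_linear hf)).
split; last exact: lbhomM.
have [g fgK] := linear_surj_section (to_linear (lbhom_linear hf)) sf.
exists g => // x; apply/eqP; rewrite -subr_eq0; apply/eqP/f_inj.
apply: etrans (linearB (to_linear (lbhom_linear hf)) _ _) _.
by rewrite fgK subrr.
Qed.

End Kernel.

Lemma isomorphic_sym {K L} : isomorphic K L -> isomorphic L K.
Proof.
case=> f [[g fK gK] fM].
have lin_g : linear g by move=> a x y; apply: (can_inj fK); rewrite linearP !gK.
exists (to_linear lin_g); split; first by exists f.
by move=> x y; apply: (can_inj fK); rewrite fM !gK.
Qed.

Lemma quot_alg_iso {K L} {f : K -> L} (hf : is_lbhom f) :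
  surj f -> isomorphic (quot_alg (lbhom_ker hf)) L.
Proof.
move=> sf; pose A := ideal_space (lbhom_ker hf).
pose g (w : quot_alg (lbhom_ker hf)) := f (vrepr (w : quotv A)).
have fq x : f (vrepr (vquo A x)) = f x.
  apply/eqP; rewrite -subr_eq0.
  have := linearB (to_linear (lbhom_linear hf)) (vrepr (vquo A x)) x => /= <-.
  by rewrite -(lbhom_kerE hf) vquoK_mem.
have hg : is_lbhom g.
  split=> [a x y | x y]; last by rewrite /g fq (lbhomM f hf).
  by rewrite /g (linearP vrepr) (lbhom_linear hf).
apply: (isomorphic_bij hg) => [y | w].
  by have [x <-] := sf y; exists (vquo A x); apply: fq.
by move/eqP; rewrite -(lbhom_kerE hf) -vquo_eq0 vreprK => /eqP.
Qed.

Lemma vquo_lbhom {K} (A : ideal K) : is_lbhom (vquo A : K -> quot_alg A).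
Proof.
by split=> [|x y]; [exact: (linearP (vquo A)) | exact/esym/vquo_mul].
Qed.

Lemma vquo_surj {K} (A : ideal K) : surj (vquo A : K -> quot_alg A).
Proof. by move=> w; exists (vrepr (w : quotv A)); apply: vreprK. Qed.

Lemma formation_surj {FF : leibnizType F -> Prop} {K L} {f : K -> L} :
  formation FF -> is_lbhom f -> surj f -> FF K -> FF L.
Proof.
move=> fFF hf sf FK.
by apply: formation_iso (quot_alg_iso hf sf) _ => //; apply: formation_quot.
Qed.

(** The two kernels meet in zero, so [K] is its own quotient by their intersection, and the
    formation axiom on intersections applies. *)
Lemma formation_subdirect {FF : leibnizType F -> Prop} {K L1 L2}
    {f1 : K -> L1} {f2 : K -> L2} :
  formation FF -> is_lbhom f1 -> is_lbhom f2 -> surj f1 -> surj f2 ->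
  (forall x, f1 x = 0 -> f2 x = 0 -> x = 0) -> FF L1 -> FF L2 -> FF K.
Proof.
move=> fFF h1 h2 s1 s2 f12 F1 F2.
have Fc : FF (quot_alg (capi (lbhom_ker h1) (lbhom_ker h2))).
  apply: formation_capi => //.
    exact: (formation_iso fFF (isomorphic_sym (quot_alg_iso h1 s1))).
  exact: (formation_iso fFF (isomorphic_sym (quot_alg_iso h2 s2))).
apply: formation_iso Fc => //; apply: isomorphic_sym.
apply: isomorphic_bij (vquo_lbhom _) (vquo_surj _) _ => x /eqP.
by rewrite vquo_eq0 memv_cap !lbhom_kerE => /andP[/eqP /f12 + /eqP] => /[apply].
Qed.

Lemma saturated_surj {FF : leibnizType F -> Prop} {K L} {f : K -> L} :
  formation FF -> saturated FF -> is_lbhom f -> surj f -> soluble K ->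
  (forall (M : {vspace K}) x, maximal_subalgebra M -> f x = 0 -> x \in M) ->
  FF L -> FF K.
Proof.
move=> fFF sFF hf sf solK fM FL.
apply: (sFF K (lbhom_ker hf)) => // [M maxM | ].
  by apply/subvP=> x; rewrite lbhom_kerE => /eqP; apply: fM.
exact: (formation_iso fFF (isomorphic_sym (quot_alg_iso hf sf))).
Qed.

(** Since [f] respects derived series, the [k]-th derived term of [K] lies in the kernel, whose
    products vanish. *)
Lemma soluble_abelian_ext {K L} {f : K -> L} :
  is_lbhom f -> (forall x y, f x = 0 -> f y = 0 -> x ** y = 0) ->
  soluble L -> soluble K.
Proof.
move=> hf abf [k Dk0].
have fD i x : x \in derived_series K i -> f x \in derived_series L i.
  elim: i x => [|i IHi] x; first by rewrite !memvf.
  pose fl := linfun (to_linear (lbhom_linear hf)).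
  suff /subvP/(_ x) : (derived_series K i.+1 <= fl @^-1: derived_series L i.+1)%VS.
    by rewrite -memv_preim lfunE.
  apply/lprodP=> u v Du Dv; rewrite -memv_preim lfunE /= (lbhomM f hf).
  by apply: memv_lprod; apply: IHi.
exists k.+1; apply/eqP; rewrite -subv0.
apply/lprodP=> x y /fD Dx /fD Dy; move: Dx Dy.
rewrite Dk0 !memv0 => /eqP fx /eqP fy.
by rewrite abf.
Qed.

End LeibnizMorphisms.

Arguments lbhom_linear {F K L f} _.
Arguments lbhomM {F K L f} _.

(** * Symmetric, antisymmetric, twisted, trivial and pulled-back modules *)

Section ModuleConstructions.
Variables (F : fieldType) (L : leibnizType F).

Section SymmetricAndAntisymmetric.
Variable M : lbmodule L.

Lemma lact_comm (x y : L) (v : M) : (x ** y) *> v = x *> (y *> v) - y *> (x *> v).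
Proof. by rewrite lactA addrK. Qed.

(** Any left action is completed to a module by the opposite right action, as for Lie modules, or by
    the zero one. *)
Definition sym_ract (v : M) (x : L) : M := - (x *> v).
Lemma sym_ract_bilinear : bilinear_for *:%R *:%R sym_ract.
Proof.
by split=> [x a v w | v a x y];
  rewrite /sym_ract ?linearPl ?linearPr opprD /= ?scalerN.
Qed.
Lemma sym_lractA x v y :
  x *> sym_ract v y = sym_ract (x *> v) y + sym_ract v (x ** y).
Proof. by rewrite /sym_ract linearNr lact_comm opprB addKr. Qed.
Lemma sym_ractA v x y :
  sym_ract v (x ** y) = sym_ract (sym_ract v x) y + x *> sym_ract v y.
Proof. by rewrite /sym_ract !linearNr opprK lact_comm opprB. Qed.
Definition sym_module : lbmodule L :=
  @LbModule F L M (fun x (v : M) => x *> v) sym_ract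
    (lact_bilinear M) sym_ract_bilinear (@lactA F L M) sym_lractA sym_ractA.

Definition asym_ract (v : M) (x : L) : M := 0.
Lemma asym_ract_bilinear : bilinear_for *:%R *:%R asym_ract.
Proof. by split=> [? ? ? ?|? ? ? ?]; rewrite /asym_ract /= scaler0 addr0. Qed.
Lemma asym_lractA x v y :
  x *> asym_ract v y = asym_ract (x *> v) y + asym_ract v (x ** y).
Proof. by rewrite /asym_ract linear0r addr0. Qed.
Lemma asym_ractA v x y :
  asym_ract v (x ** y) = asym_ract (asym_ract v x) y + x *> asym_ract v y.
Proof. by rewrite /asym_ract linear0r addr0. Qed.
Definition asym_module : lbmodule L :=
  @LbModule F L M (fun x (v : M) => x *> v) asym_ract
    (lact_bilinear M) asym_ract_bilinear (@lactA F L M) asym_lractA asym_ractA.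

(* A non-split extension of [sym_module] by [asym_module]. *)
Section Twist.
Variables (t : {linear L -> F^o}) (tM : forall x y, t (x ** y) = 0).

Definition twist_lact (x : L) (v : M * M) : M * M := (x *> v.1, x *> v.2).
(** The component [t x *: v.1] is the extra product m t = m'. It obeys the two laws on right actions
    because [t] vanishes on products. *)
Definition twist_ract (v : M * M) (x : L) : M * M := (- (x *> v.1), t x *: v.1).
Lemma twist_lact_bilinear : bilinear_for *:%R *:%R twist_lact.
Proof.
by split=> [v a x y | x a v w]; congr pair; rewrite /= ?linearPl ?linearPr.
Qed.
Lemma twist_ract_bilinear : bilinear_for *:%R *:%R twist_ract.
Proof.
split=> [x a v w | v a x y]; congr pair => /=.
- by rewrite linearPr opprD scalerN.
- by rewrite scalerDr !scalerA mulrC.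
- by rewrite linearPl opprD scalerN.
- by rewrite linearP scalerDl -scalerA.
Qed.
Lemma twist_lactA x y v :
  twist_lact x (twist_lact y v)
  = twist_lact (x ** y) v + twist_lact y (twist_lact x v).
Proof. by congr pair; rewrite /= lactA. Qed.
Lemma twist_lractA x v y :
  twist_lact x (twist_ract v y)
  = twist_ract (twist_lact x v) y + twist_ract v (x ** y).
Proof.
congr pair => /=; first exact: sym_lractA.
by rewrite tM scale0r addr0 linearZr.
Qed.
Lemma twist_ractA v x y :
  twist_ract v (x ** y)
  = twist_ract (twist_ract v x) y + twist_lact x (twist_ract v y).
Proof.
congr pair => /=; first exact: sym_ractA.
by rewrite tM scale0r linearZr /= scalerN addNr.
Qed.
Definition twist_module : lbmodule L :=
  @LbModule F L (M * M)%type twist_lact twist_ract twist_lact_bilinear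
    twist_ract_bilinear twist_lactA twist_lractA twist_ractA.
End Twist.

End SymmetricAndAntisymmetric.

Definition triv_act (x : L) (v : F^o) : F^o := 0.
Lemma triv_act_bilinear : bilinear_for *:%R *:%R triv_act.
Proof. by split=> [? ? ? ?|? ? ? ?]; rewrite /triv_act /= scaler0 addr0. Qed.
Lemma triv_ract_bilinear : bilinear_for *:%R *:%R (fun v x => triv_act x v).
Proof. by split=> [? ? ? ?|? ? ? ?]; rewrite /triv_act /= scaler0 addr0. Qed.
Lemma triv_actA (x y : L) (v w : F^o) : 0 = (0 : F^o) + 0.
Proof. by rewrite addr0. Qed.
Definition triv_module : lbmodule L :=
  @LbModule F L F^o triv_act (fun v x => triv_act x v) triv_act_bilinear
    triv_ract_bilinear (fun x y v => triv_actA x y v v)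
    (fun x v y => triv_actA x y v v) (fun v x y => triv_actA x y v v).

Section PullBack.
Variables (K : leibnizType F) (f : K -> L) (hf : is_lbhom F f) (M : lbmodule L).

Lemma pull_lact_bilinear :
  bilinear_for *:%R *:%R (fun (x : K) (v : M) => f x *> v).
Proof.
by split=> [v a x y | x a v w] /=; rewrite ?(lbhom_linear hf) ?linearPl ?linearPr.
Qed.
Lemma pull_ract_bilinear :
  bilinear_for *:%R *:%R (fun (v : M) (x : K) => v <* f x).
Proof.
by split=> [x a v w | v a x y] /=; rewrite ?(lbhom_linear hf) ?linearPl ?linearPr.
Qed.
Lemma pull_lactA x y (v : M) :
  f x *> (f y *> v) = f (x ** y) *> v + f y *> (f x *> v).
Proof. by rewrite (lbhomM hf) lactA. Qed.
Lemma pull_lractA x (v : M) y :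
  f x *> (v <* f y) = (f x *> v) <* f y + v <* f (x ** y).
Proof. by rewrite (lbhomM hf) lractA. Qed.
Lemma pull_ractA (v : M) x y :
  v <* f (x ** y) = (v <* f x) <* f y + f x *> (v <* f y).
Proof. by rewrite (lbhomM hf) ractA. Qed.
Definition pull_module : lbmodule K :=
  @LbModule F K M _ _ pull_lact_bilinear pull_ract_bilinear
    pull_lactA pull_lractA pull_ractA.
End PullBack.

End ModuleConstructions.

(** * Split extensions and their membership in a formation *)

Section SplitExtensions.
Variables (F : fieldType).
Implicit Types K L : leibnizType F.

Lemma split_fst_lbhom {K} (M : lbmodule K) :
  is_lbhom F (fst : split_ext M -> K).
Proof. by []. Qed.

Lemma split_fst_surj {K} (M : lbmodule K) : surj (fst : split_ext M -> K).
Proof. by move=> x; exists (x, 0). Qed.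

(** Modulo [B] the map [psi] embeds [M] as a square-zero ideal with the given actions. Hence (x, m)
    |-> x + psi m + B is multiplicative, and together with the projection to [K] it makes the split
    extension subdirect in K x K/B. *)
Lemma formation_split {FF : leibnizType F -> Prop} {K} (B : ideal K)
    {M : lbmodule K} (psi : {linear M -> K}) :
  formation FF -> FF K ->
  (forall x m, x ** psi m - psi (x *> m) \in (B : {vspace K})) ->
  (forall x m, psi m ** x - psi (m <* x) \in (B : {vspace K})) ->
  (forall m m', psi m ** psi m' \in (B : {vspace K})) ->
  (forall m, psi m \in (B : {vspace K}) -> m = 0) -> FF (split_ext M).
Proof.
move=> fFF FK Bl Br Bab Binj.
pose f (p : split_ext M) : quot_alg B := vquo B (p.1 + psi p.2).
have hf : is_lbhom F f.
  split=> [a p q | [x v] [y w]].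
    by rewrite /f !linearP /= addrACA -scalerDr linearP.
  rewrite /f -(lbhomM (vquo_lbhom F B)) /=; apply: vquo_eqP.
  rewrite !linearD /= !linearDl /= !linearDr /= -rpredN opprB.
  have -> : x ** y + x ** psi w + (psi v ** y + psi v ** psi w)
            - (x ** y + (psi (x *> w) + psi (v <* y)))
          = (x ** psi w - psi (x *> w)) + (psi v ** y - psi (v <* y))
            + psi v ** psi w.
    rewrite !opprD [LHS](AC (2*2*(1*2)) (((2*6)*(3*7)*4)*(1*5))).
    by rewrite /= subrr addr0.
  by rewrite rpredD ?Bab // rpredD ?Bl ?Br.
apply: (formation_subdirect F fFF (split_fst_lbhom M) hf) => //.
- exact: split_fst_surj.
- move=> w; exists (vrepr (w : quotv B), 0).
  by rewrite /f /= linear0 addr0 vreprK.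
- move=> [x m] /= -> /eqP; rewrite /f /= add0r vquo_eq0 => /Binj ->.
  by [].
- exact: formation_quot.
Qed.

Section Twist.
Variables (K : leibnizType F) (M : lbmodule K) (t : {linear K -> F^o}).
Hypothesis tM : forall x y, t (x ** y) = 0.
Let E := split_ext (twist_module F K M t tM).
Let f (p : E) : split_ext (sym_module F K M) := (p.1, p.2.1).

Lemma twist_lbhom : is_lbhom F f.
Proof. by split=> // [a [x [m m']] [y [n n']]]. Qed.

Lemma twist_Frattini (p0 : K) (S : {vspace E}) (m : M) :
  t p0 = 1 -> (forall v : M, p0 *> v = 0) -> maximal_subalgebra S ->
  ((0, (0, m)) : E) \in S.
Proof.
move=> tp0 p0M [subS _ maxS].
pose A := ideal_space (lbhom_ker F twist_lbhom).
have Am v : ((0, (0, v)) : E) \in A by rewrite lbhom_kerE.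
(* [A] is the second copy of [M]. As it is an ideal, maximality makes [S + A] equal to [S] or to
   everything. *)
have subSA : is_subalgebra (S + A)%VS.
  move=> _ _ /memv_addP[s Ss [a Aa ->]] /memv_addP[s' Ss' [a' Aa' ->]].
  rewrite linearDl linearDr /= -addrA memv_add ?subS //.
  rewrite rpredD //; first exact: (@ideal_mull F E (lbhom_ker F twist_lbhom)).
  exact: (@ideal_mulr F E (lbhom_ker F twist_lbhom)).
have [SA | SA] := maxS _ subSA (addvSl S A).
  by rewrite -SA (subvP (addvSr S A)).
have lift (p : E) : exists a, ((p.1, (p.2.1, a)) : E) \in S.
  have /memv_addP[s Ss [a]] : p \in (S + A)%VS by rewrite SA memvf.
  rewrite lbhom_kerE => /eqP[a1 a2] ->.
  by exists s.2.2; rewrite /= a1 a2 !addr0; case: s Ss {a1 a2} => ? [].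
(* The product of the lifts is (0, (-(p0 m), t(p0) m)) = (0, (0, m)): the unknown components [a] and
   [b] disappear. *)
have [a Sa] := lift (0, (m, 0)); have [b Sb] := lift (p0, (0, 0)).
have := subS _ _ Sa Sb; congr (_ \in S); congr pair => /=.
  by rewrite linear0l.
by congr pair; rewrite /= linear0l add0r ?p0M ?oppr0 // tp0 scale1r.
Qed.

End Twist.

End SplitExtensions.

(** * The one-dimensional abelian algebra *)

Definition abelian_line (F : fieldType) : Type := F^o.
HB.instance Definition _ (F : fieldType) := Vector.on (abelian_line F).

Section AbelianLine.
Variable F : fieldType.

Definition line_mul (x y : abelian_line F) : abelian_line F := 0.
Lemma line_mul_bilinear : bilinear_for *:%R *:%R line_mul.
Proof. by split=> [? ? ? ?|? ? ? ?]; rewrite /line_mul /= scaler0 addr0. Qed.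
Lemma line_mulA a x y :
  line_mul a (line_mul x y) = line_mul (line_mul a x) y + line_mul x (line_mul a y).
Proof. by rewrite /line_mul addr0. Qed.
HB.instance Definition _ :=
  isLeibniz.Build F (abelian_line F) line_mul_bilinear line_mulA.
End AbelianLine.

(** * Antisymmetric split extensions in a saturated formation *)

Section FormationsClosure.
Variables (F : fieldType) (FF : leibnizType F -> Prop).
Hypothesis fFF : formation FF.
Implicit Types K L : leibnizType F.

Lemma zero_ideal_subproof {K} : @is_ideal_of F K 0%VS fullv.
Proof.
split=> [|x a _]; first exact: subvf.
by rewrite !memv0 => /eqP->; rewrite linear0r linear0l eqxx.
Qed.
Definition zero_ideal K : ideal K := Ideal (@zero_ideal_subproof K).

(** A nonzero soluble algebra differs from its derived algebra, as otherwise its derived series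
    would be constant. A coordinate on a complement of the derived algebra gives [t]. *)
Lemma soluble_functional {K} : soluble K -> \dim {:K} <> 0%N ->
  exists t : {linear K -> F^o}, (forall x y, t (x ** y) = 0) /\ surj t.
Proof.
move=> [i Di0] /eqP; rewrite dimv_eq0 => K0.
pose D := lprod (fullv : {vspace K}) fullv.
have DnK : D <> fullv.
  move=> DK; move/eqP: K0; apply; rewrite -Di0; elim: {Di0} i => //= i <-.
  by rewrite -/D DK.
pose b := vbasis (D^C)%VS.
have Cn0 : (0 < \dim (D^C))%N.
  rewrite lt0n dimv_eq0; apply/eqP=> C0; apply: DnK.
  by have := addv_complf D; rewrite C0 addv0.
pose j : 'I_(\dim (D^C)) := Ordinal Cn0.
pose t (x : K) : F^o := coord b j (daddv_pi (D^C) D x).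
have lin_t : linear t by move=> a x y; rewrite /t !linearP.
have DC : (D :&: D^C = 0)%VS := capv_compl D.
exists (to_linear lin_t); split=> [x y | c]; rewrite /= /t.
  suff -> : daddv_pi (D^C) D (x ** y) = 0 by rewrite linear0.
  have xyD : x ** y \in D by rewrite memv_lprod ?memvf.
  have DC' : (D^C :&: D = 0)%VS by rewrite capvC.
  have /(daddv_pi_add DC') : x ** y \in (D^C + D)%VS by rewrite (subvP (addvSr _ _)).
  by rewrite (daddv_pi_id DC xyD) -[RHS]add0r => /addIr.
exists (c *: b`_j); rewrite daddv_pi_id ?(capvC (D^C)%VS) ?memvZ //.
  have := coord_free j j (basis_free (vbasisP (D^C)%VS)).
  by rewrite linearZ eqxx /= => ->; apply: mulr1.
by rewrite vbasis_mem // mem_nth // size_tuple.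
Qed.

Hypothesis sFF : saturated FF.

Lemma formation_asym_twist {K} (M : lbmodule K) (t : {linear K -> F^o}) (p0 : K) :
  (forall x y, t (x ** y) = 0) -> t p0 = 1 -> (forall v : M, p0 *> v = 0) ->
  FF (split_ext (sym_module F K M)) -> FF (split_ext (asym_module F K M)).
Proof.
move=> tM tp0 p0M Fsym; pose E := split_ext (twist_module F K M t tM).
have FE : FF E.
  have hf := twist_lbhom F K M t tM.
  apply: (saturated_surj F fFF sFF hf) => //.
  - by move=> [p m]; exists (p, (m, 0)).
  - apply: (soluble_abelian_ext F hf) (formation_soluble fFF Fsym).
    move=> [x [m m']] [y [n n']] [/= -> ->] [/= -> ->].
    congr pair; rewrite /= ?linear0l //; congr pair => /=.
      by rewrite !linear0l oppr0 addr0.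
    by rewrite linear0l scaler0 addr0.
  - move=> S [x [m m']] maxS [/= -> ->].
    exact: (twist_Frattini F K M t tM p0).
(* [E] acts on the second copy of [M] through [K], with zero right action since the twisted term
   reads only the first copy. So this ideal is [M2], and [formation_split] applies with zero for
   [B]. *)
pose M2 := pull_module F K E fst (split_fst_lbhom F _) (asym_module F K M).
have lin_psi : linear (fun w : M => (0, (0, w)) : E).
  by move=> a v w; congr pair; [|congr pair]; rewrite /= scaler0 addr0.
have FE2 : FF (split_ext M2).
  apply: (@formation_split F FF E (zero_ideal E) M2 (to_linear lin_psi)) => //=.
  - move=> [x [m m']] w; rewrite memv0 subr_eq0; apply/eqP.
    congr pair => /=; first exact: linear0r.
    congr pair => /=; first by rewrite !linear0r linear0l oppr0 addr0.
    by rewrite linear0 scale0r addr0.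
  - move=> [x [m m']] w; rewrite memv0 subr_eq0; apply/eqP.
    congr pair => /=; first exact: linear0l.
    by congr pair => /=; rewrite !(linear0l, linear0r, oppr0, scaler0, addr0).
  - move=> v w; rewrite memv0; apply/eqP.
    congr pair => /=; first exact: linear0l.
    by congr pair => /=; rewrite !(linear0l, linear0r, oppr0, scaler0, addr0).
  - by move=> w; rewrite memv0 => /eqP[->].
pose g (q : split_ext M2) : split_ext (asym_module F K M) := (q.1.1, q.2).
have hg : is_lbhom F g by [].
apply: (formation_surj F fFF hg) FE2.
by move=> [x m]; exists ((x, (0, 0)), m).
Qed.

Hypothesis FF_nonzero : exists K, FF K /\ \dim {:K} <> 0%N.

Lemma formation_line : FF (abelian_line F).
Proof.
have [K [FK /(soluble_functional (formation_soluble fFF FK))[t [tM t_surj]]]] :=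
  FF_nonzero.
have ht : is_lbhom F (t : K -> abelian_line F).
  by split=> [a x y | x y]; [apply: linearP | apply: tM].
exact: (formation_surj F fFF ht).
Qed.

(** [K] may contain no suitable [p0], so the direct product [P] of [K] with a line is used, and the
    line is dropped at the end. *)
Lemma formation_asym {K} (M : lbmodule K) :
  FF (split_ext (sym_module F K M)) -> FF (split_ext (asym_module F K M)).
Proof.
move=> Fsym.
have FK : FF K.
  apply: (formation_surj F fFF (split_fst_lbhom F _)) Fsym.
  exact: split_fst_surj.
pose P := split_ext (triv_module F K).
have fst_hom : is_lbhom F (fst : P -> K) := split_fst_lbhom F _.
have snd_lin : linear (snd : P -> F^o) by [].
have sndM (p q : P) : (p ** q).2 = 0 by apply: addr0.
have snd_hom : is_lbhom F (snd : P -> abelian_line F) by [].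
have FP : FF P.
  apply: (formation_subdirect F fFF fst_hom snd_hom _ _ _ FK formation_line).
  - exact: split_fst_surj.
  - by move=> c; exists (0, c).
  - by move=> [x c] /= -> ->.
pose MP := pull_module F K P fst fst_hom M.
have FsymP : FF (split_ext (sym_module F P MP)).
  pose g (q : split_ext (sym_module F P MP)) : split_ext (sym_module F K M) :=
    (q.1.1, q.2).
  have hg : is_lbhom F g by [].
  apply: (formation_subdirect F fFF (split_fst_lbhom F _) hg _ _ _ FP Fsym).
  - exact: split_fst_surj.
  - by move=> [x m]; exists ((x, 0), m).
  - by move=> [[x c] m] /= [-> ->] [->].
have FasymP : FF (split_ext (asym_module F P MP)).
  (* The line coordinate is the functional, and [(0, 1)] acts as zero on [M] through its component
     in [K]. *)
  apply: (formation_asym_twist MP (to_linear snd_lin) (0, 1)) => // v.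
  by rewrite /= linear0l.
pose g (q : split_ext (asym_module F P MP)) : split_ext (asym_module F K M) :=
  (q.1.1, q.2).
have hg : is_lbhom F g by [].
apply: (formation_surj F fFF hg) FasymP.
by move=> [x m]; exists ((x, 0), m).
Qed.

End FormationsClosure.

(** * Maximal and minimal subspaces with a given property *)

Section Extremal.
Context {F : fieldType} {V : vectType F}.
Variable P : {vspace V} -> Prop.

Lemma ex_maximal_vspace A :
  P A -> exists B, P B /\ forall C, P C -> (B <= C)%VS -> C = B.
Proof.
have [m le_m] := ubnP (\dim {:V} - \dim A)%N.
elim: m A le_m => // m IHm A lt_m PA.
have [[C [PC AC CA]] | noC] := classic (exists C, [/\ P C, (A <= C)%VS & C <> A]).
  apply: (IHm C) => //.
  have ltAC : (\dim A < \dim C)%N.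
    rewrite ltn_neqAle dimvS // andbT; apply/eqP=> dAC.
    by apply/CA/eqP; rewrite eq_sym eqEdim AC dAC leqnn.
  rewrite -ltnS; apply: leq_trans lt_m; rewrite ltnS ltn_sub2l //.
  by apply: leq_trans ltAC _; apply/dimvS/subvf.
exists A; split=> // C PC AC; apply: NNPP => CA.
by apply: noC; exists C.
Qed.

Lemma ex_minimal_vspace A :
  P A -> exists B, P B /\ forall C, P C -> (C <= B)%VS -> C = B.
Proof.
have [m le_m] := ubnP (\dim A).
elim: m A le_m => // m IHm A lt_m PA.
have [[C [PC CA nCA]] | noC] := classic (exists C, [/\ P C, (C <= A)%VS & C <> A]).
  apply: (IHm C) => //.
  rewrite -ltnS; apply: leq_trans lt_m; rewrite ltnS.
  rewrite ltn_neqAle dimvS // andbT; apply/eqP=> dAC.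
  by apply/nCA/eqP; rewrite eqEdim CA dAC leqnn.
exists A; split=> // C PC CA; apply: NNPP => nCA.
by apply: noC; exists C.
Qed.

End Extremal.

(** * Ideals and chief factors *)

Section Ideals.
Context {F : fieldType} {L : leibnizType F}.
Implicit Types A B : {vspace L}.
Local Notation is_ideal A := (is_ideal_of A fullv).

Lemma mem_ideall {A} x a : is_ideal A -> a \in A -> x ** a \in A.
Proof. by case=> _ idA /(idA x a (memvf x))[]. Qed.
Lemma mem_idealr {A} a x : is_ideal A -> a \in A -> a ** x \in A.
Proof. by case=> _ idA /(idA x a (memvf x))[]. Qed.

Lemma is_ideal_add A B : is_ideal A -> is_ideal B -> is_ideal (A + B)%VS.
Proof.
move=> idA idB; split=> [|x _ _ /memv_addP[a Aa [b Bb ->]]]; first exact: subvf.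
by rewrite linearDl linearDr; split; apply: memv_add;
  first [exact: mem_ideall | exact: mem_idealr].
Qed.

Lemma is_ideal_lprod A : is_ideal A -> is_ideal (lprod A A).
Proof.
move=> idA; split=> [|x u _ uAA]; first exact: subvf.
pose f : {bilinear L -> L -> L | *:%R & *:%R} := @lbmul F L.
have fl : (lprod A A <= linfun (f x) @^-1: lprod A A)%VS.
  apply/lprodP=> a b Aa Ab; rewrite -memv_preim lfunE /f /= lbmulA.
  by rewrite rpredD ?memv_lprod ?mem_ideall.
have fr : (lprod A A <= linfun (applyr f x) @^-1: lprod A A)%VS.
  apply/lprodP=> a b Aa Ab; rewrite -memv_preim lfunE /f /=.
  have /eqP := lbmulA a b x; rewrite -subr_eq => /eqP <-.
  by rewrite rpredB ?memv_lprod ?mem_idealr.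
split; first by move/subvP: fl => /(_ u uAA); rewrite -memv_preim lfunE.
by move/subvP: fr => /(_ u uAA); rewrite -memv_preim lfunE.
Qed.

(** Left multiplication by xy is the commutator of those by x and y, hence skew in x and y. *)
Lemma lbmul_anticomm (x y z : L) : (x ** y + y ** x) ** z = 0.
Proof.
apply: (addIr (y ** (x ** z))).
by rewrite add0r linearDl /= addrAC -lbmulA addrC -lbmulA.
Qed.

Section ChiefFactor.
Variables A B : {vspace L}.
Hypotheses (idA : is_ideal A) (idB : is_ideal B) (sBA : (B <= A)%VS).
Hypothesis nAB : A <> B.
Hypothesis chiefAB :
  forall C, is_ideal C -> (B <= C)%VS -> (C <= A)%VS -> C = B \/ C = A.

(** The ideal [B + lprod A A] is [B] or [A]. If it were [A], substituting this equality into itself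
    would put [A] into B + L^(i) for every i, hence into [B]. *)
Lemma chief_factor_abelian : soluble L -> (lprod A A <= B)%VS.
Proof.
move=> [k Dk0]; have idAA := is_ideal_lprod A idA.
have sAAA : (lprod A A <= A)%VS by apply/lprodP=> x y Ax Ay; apply: mem_ideall.
have sBAA : (B + lprod A A <= A)%VS by rewrite subv_add sBA.
have [<- | AAB] := chiefAB _ (is_ideal_add _ _ idB idAA) (addvSl _ _) sBAA.
  exact: addvSr.
case: nAB; apply/eqP; rewrite eqEsubv sBA andbT.
suff sAD i : (A <= B + derived_series L i)%VS by have := sAD k; rewrite Dk0 addv0.
elim: i => [|i IHi]; first exact: subv_trans (subvf A) (addvSr _ _).
rewrite -{1}AAB subv_add addvSl; apply/lprodP=> x y.
move=> /(subvP IHi)/memv_addP[b Bb [d Dd ->]].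
move=> /(subvP IHi)/memv_addP[b' Bb' [d' Dd' ->]].
rewrite linearDl /= [X in _ + X]linearDr addrA /=.
apply: memv_add; last exact: memv_lprod.
by apply: rpredD; [exact: mem_idealr | exact: mem_ideall].
Qed.

(** The a in [A] with aL inside [B] form an ideal [A0], which is [A], giving the first case, or [B].
    Then ax + xa, whose left multiplication is zero, lies in [A0] and so in [B]. *)
Lemma chief_factor_cases :
  (forall a x, a \in A -> a ** x \in B) \/
  (forall a x, a \in A -> a ** x + x ** a \in B).
Proof.
pose f : {bilinear L -> L -> L | *:%R & *:%R} := @lbmul F L.
pose h (a : L) := linfun (vquo B \o f a).
have lin_h : linear h.
  move=> c a b; apply/lfunP=> y.
  by rewrite add_lfunE scale_lfunE !lfunE /= linearPl linearP.
pose A0 := (A :&: lker (linfun (to_linear lin_h)))%VS.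
have A0P a : reflect (a \in A /\ forall y, a ** y \in B) (a \in A0).
  rewrite memv_cap memv_ker lfunE /=.
  apply: (iffP andP) => -[Aa hB]; split=> //.
    move=> y; rewrite -vquo_eq0; move/eqP/lfunP/(_ y): hB.
    by rewrite !lfunE /= => ->.
  apply/eqP/lfunP=> y; rewrite zero_lfunE lfunE.
  by apply/eqP; rewrite vquo_eq0 hB.
have idA0 : is_ideal A0.
  split=> [|x a _ /A0P[Aa aB]]; first exact: subvf.
  split; apply/A0P; split=> [|y]; [exact: mem_ideall| |exact: mem_idealr|].
    have /eqP := lbmulA x a y; rewrite -subr_eq => /eqP <-.
    by apply: rpredB => //; apply: mem_ideall.
  have /eqP := lbmulA a x y; rewrite -subr_eq => /eqP <-.
  by apply: rpredB => //; apply: mem_ideall.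
have sBA0 : (B <= A0)%VS.
  apply/subvP=> b Bb; apply/A0P; split=> [|y]; first exact: (subvP sBA).
  exact: mem_idealr.
have [A0B | A0A] := chiefAB A0 idA0 sBA0 (capvSl _ _); [right | left] => a x Aa.
  rewrite -A0B; apply/A0P; split=> [|y]; last by rewrite lbmul_anticomm rpred0.
  by apply: rpredD; [exact: mem_idealr | exact: mem_ideall].
by move: Aa; rewrite -{1}A0A => /A0P[].
Qed.

End ChiefFactor.
End Ideals.

(** * Irreducible modules *)

Section IrreducibleModules.
Context {F : fieldType} {L : leibnizType F} (W : lbmodule L).
Hypothesis irrW : irreducible W.

Lemma irreducible_sub (Z : {vspace W}) :
  is_submodule Z -> Z = 0%VS \/ Z = fullv.
Proof. by move=> subZ; have [_ /(_ (Submodule subZ))] := irrW. Qed.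

(** The vectors killed by all right actions form a submodule, because (xw)y = x(wy) - w(xy). It
    contains every wx, so these vanish even if it is zero. *)
Lemma irreducible_ract0 :
  (forall (w : W) x y, (w <* x) <* y = 0) -> forall (w : W) x, w <* x = 0.
Proof.
move=> rr0.
pose f : {bilinear W -> L -> W | *:%R & *:%R} := @ract F L W.
pose h (w : W) := linfun (f w).
have lin_h : linear h.
  move=> c a b; apply/lfunP=> y.
  by rewrite add_lfunE scale_lfunE !lfunE /= linearPl.
pose Z := lker (linfun (to_linear lin_h)).
have ZP w : reflect (forall x, w <* x = 0) (w \in Z).
  rewrite memv_ker lfunE /=; apply: (iffP eqP) => [hw x | w0].
    by move/lfunP/(_ x): hw; rewrite lfunE zero_lfunE.
  by apply/lfunP=> x; rewrite lfunE zero_lfunE; apply: w0.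
have subZ : is_submodule Z.
  move=> x w /ZP w0; split; apply/ZP=> y; last exact: rr0.
  have := lractA x w y; rewrite !w0 linear0r addr0.
  by move/esym.
case: (irreducible_sub Z subZ) => [Z0 | Zf] w x.
  by apply/eqP; rewrite -memv0 -Z0; apply/ZP=> y; apply: rr0.
by apply: (ZP w _); rewrite Zf memvf.
Qed.

Hypothesis ract0 : forall (w : W) x, w <* x = 0.

Lemma irreducible_lact0 :
  (forall (w : W) x, x *> w = 0) \/
  (forall w : W, (forall x, x *> w = 0) -> w = 0).
Proof.
pose f : {bilinear L -> W -> W | *:%R & *:%R} := @lact F L W.
pose h (w : W) := linfun (applyr f w).
have lin_h : linear h.
  move=> c a b; apply/lfunP=> y.
  by rewrite add_lfunE scale_lfunE !lfunE /= linearPr.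
pose Z := lker (linfun (to_linear lin_h)).
have ZP w : reflect (forall x, x *> w = 0) (w \in Z).
  rewrite memv_ker lfunE /=; apply: (iffP eqP) => [hw x | w0].
    by move/lfunP/(_ x): hw; rewrite lfunE zero_lfunE.
  by apply/lfunP=> x; rewrite lfunE zero_lfunE; apply: w0.
have subZ : is_submodule Z.
  by move=> x w /ZP w0; rewrite ract0 w0 rpred0.
case: (irreducible_sub Z subZ) => [Z0 | Zf]; [right=> w w0 | left=> w x].
  by apply/eqP; rewrite -memv0 -Z0; apply/ZP.
by apply: (ZP w _); rewrite Zf memvf.
Qed.

Lemma irreducible_image (D : {vspace L}) (p : {linear L -> W}) :
  (forall x d, d \in D -> x ** d \in D /\ p (x ** d) = x *> p d) ->
  (exists2 d, d \in D & p d != 0) -> forall w, exists2 d, d \in D & p d = w.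
Proof.
move=> Dp [d0 Dd0 pd0] w.
have subI : is_submodule (linfun p @: D)%VS.
  move=> x _ /memv_imgP[d Dd ->]; rewrite ract0 rpred0; split=> //.
  have [Dxd pxd] := Dp x d Dd.
  by rewrite lfunE /= -pxd -[p _](lfunE p) memv_img.
have [I0 | If] := irreducible_sub _ subI.
  case/eqP: pd0; apply/eqP; rewrite -memv0 -I0 -[p d0](lfunE p).
  exact: memv_img.
have : w \in (linfun p @: D)%VS by rewrite If memvf.
by case/memv_imgP=> d Dd ->; exists d; rewrite ?lfunE.
Qed.

End IrreducibleModules.

(** * Centrality of irreducible modules with zero right action *)

Section Centrality.
Context {F : fieldType} {FF : leibnizType F -> Prop}.
Hypotheses (fFF : formation FF) (sFF : saturated FF).
Hypothesis FF_nonzero : exists K, FF K /\ \dim {:K} <> 0%N.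
Context {U : leibnizType F} {W : lbmodule U}.
Hypothesis irrW : irreducible W.
Hypothesis ract0 : forall (w : W) x, w <* x = 0.

(** Every subspace of [W] is a submodule, so [W] is a line and U/ker(W) is zero. The split extension
    is then the abelian line, a quotient of any nonzero soluble algebra. *)
Lemma central_trivial :
  (forall (w : W) x, x *> w = 0) -> FF (split_ext (module_mod_ker W)).
Proof.
move=> lact0; have [K [FK /(soluble_functional F (formation_soluble fFF FK))]] :=
  FF_nonzero.
move=> [t [tM t_surj]].
pose w0 := vpick {:W}.
have w0_n0 : w0 != 0 by rewrite vpick0; apply/eqP; case: irrW.
have Ww0 : <[w0]>%VS = fullv.
  have [|/eqP|//] := irreducible_sub W irrW <[w0]>%VS.
    by move=> x w _; rewrite lact0 ract0 rpred0.
  by rewrite -dimv_eq0 dim_vline w0_n0.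
pose g (x : K) : split_ext (module_mod_ker W) := (0, t x *: w0).
have hg : is_lbhom F g.
  split=> [a x y | x y]; congr pair => /=.
  - by rewrite scaler0 addr0.
  - by rewrite linearP scalerDl -scalerA.
  - by rewrite linear0l.
  - by rewrite tM scale0r [RHS]/= /mk_lact /mk_ract lact0 ract0 addr0.
apply: (formation_surj F fFF hg _ FK) => -[q w].
have /vlineP[c ->] : w \in <[w0]>%VS by rewrite Ww0 memvf.
have [x tx] := t_surj c; exists x; rewrite /g tx; congr pair.
apply/esym/eqP; rewrite -[q]vreprK vquo_eq0.
by apply/modkerP=> v; rewrite lact0 ract0.
Qed.

(** [S] is only known to be stable under left multiplication; the proof passes from it to a chief
    factor A/B of [U] carrying the left module [W]. *)
Lemma central_section (S : {vspace U}) (p : {linear U -> W}) :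
  FF U -> (forall x s, s \in S -> x ** s \in S /\ p (x ** s) = x *> p s) ->
  (exists2 s, s \in S & p s != 0) -> FF (split_ext (module_mod_ker W)).
Proof.
move=> FU Sp [s0 Ss0 ps0].
have solU := formation_soluble fFF FU.
suff Fasym : FF (split_ext (asym_module F U W)).
  pose g (q : split_ext (asym_module F U W)) : split_ext (module_mod_ker W) :=
    (vquo (modker W) q.1, q.2).
  have hg : is_lbhom F g.
    split=> [a x y | [x v] [y w]]; congr pair => //=.
    - exact: linearP.
    - exact: (lbhomM (vquo_lbhom F (modker_ideal W))).
    - by rewrite mk_lactE mk_ractE ract0 /asym_ract.
  apply: (formation_surj F fFF hg _ Fasym) => -[q w].
  by exists (vrepr q, w); rewrite /g /= vreprK.
(* [B] will be a maximal ideal among those with [p] zero on [S :&: B], and [A] a minimal ideal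
   strictly above it, so that [p] is nonzero on [S :&: A]. *)
pose PB (B : {vspace U}) :=
  is_ideal_of B fullv /\ forall s, s \in S -> s \in B -> p s = 0.
have PB0 : PB 0%VS.
  split=> [|s _]; first exact: (idealP (zero_ideal F U)).
  by rewrite memv0 => /eqP->; rewrite linear0.
have [B [[idB SB0] maxB]] := ex_maximal_vspace PB _ PB0.
pose PA (A : {vspace U}) := [/\ is_ideal_of A fullv, (B <= A)%VS & A <> B].
have PAf : PA fullv.
  split; [by split=> // x a _ _; rewrite !memvf | exact: subvf | move=> Bf].
  by case/eqP: ps0; apply: SB0; rewrite // -Bf memvf.
have [A [[idA sBA nAB] minA]] := ex_minimal_vspace PA _ PAf.
have chiefAB C : is_ideal_of C fullv -> (B <= C)%VS -> (C <= A)%VS ->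
    C = B \/ C = A.
  move=> idC sBC sCA; have [-> | nCB] := classic (C = B); first by left.
  by right; apply: minA.
pose D := (S :&: A)%VS.
have DP x : reflect (x \in S /\ x \in A) (x \in D).
  by rewrite memv_cap; apply: andP.
have Dp x d : d \in D -> x ** d \in D /\ p (x ** d) = x *> p d.
  case/DP=> Sd Ad; have [Sxd pxd] := Sp x d Sd; split=> //.
  by apply/DP; split=> //; apply: mem_ideall.
have D_n0 : exists2 d, d \in D & p d != 0.
  apply: NNPP => noD; apply: nAB; apply: maxB sBA; split=> // s Ss As.
  apply/eqP; apply: contraPT noD => ps noD; apply: noD; exists s => //.
  exact/DP.
have sAAB := chief_factor_abelian A B idA idB sBA nAB chiefAB solU.
have symA := chief_factor_cases A B idA idB sBA chiefAB.
(* [T] is an ideal because modulo [B] the right action on [A] is zero or opposite to the left one.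
   If [T] were [A], each d in [D] would be u + b with p u = 0 and b in [S :&: B], so p d = 0. Hence
   [T] is [B]. *)
pose T := (D :&: lker (linfun p) + B)%VS.
have DkerB d : d \in D -> p d = 0 -> d \in B.
  have sBT : (B <= T)%VS := addvSr _ _.
  have sTA : (T <= A)%VS.
    by rewrite subv_add sBA andbT; apply: subv_trans (capvSl _ _) (capvSr _ _).
  have lT x u : u \in T -> x ** u \in T.
    case/memv_addP=> d1; rewrite memv_cap memv_ker lfunE /= => /andP[Dd1 /eqP pd1].
    case=> b Bb ->; rewrite linearDr; apply: memv_add; last exact: mem_ideall.
    have [Dxd pxd] := Dp x d1 Dd1.
    by rewrite memv_cap Dxd memv_ker lfunE /= pxd pd1 linear0r.
  have idT : is_ideal_of T fullv.
    split=> [|x u _ Tu]; first exact: subvf.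
    split; first exact: lT.
    have Au := subvP sTA u Tu.
    case: symA => [asymA | symA]; first exact/(subvP sBT)/asymA.
    rewrite -(addrK (x ** u) (u ** x)) rpredB ?lT //.
    exact/(subvP sBT)/symA.
  have [TB | TA] := chiefAB T idT sBT sTA => Dd pd.
    rewrite -TB; apply: (subvP (addvSl _ _)).
    by rewrite memv_cap Dd memv_ker lfunE /= pd.
  have [d1 Dd1 /eqP[]] := D_n0.
  have [_ Ad1] := DP _ Dd1.
  move: Ad1; rewrite -TA => /memv_addP[u].
  rewrite memv_cap memv_ker lfunE /= => /andP[/DP[Su _] /eqP pu] [b Bb d1E].
  rewrite d1E linearD pu add0r; apply: SB0 => //.
  have -> : b = d1 - u by rewrite d1E addrC addKr.
  by rewrite rpredB //; case/DP: Dd1.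
(* Projecting onto [D] extends the restriction of [p] to all of [U]; a section of it, projected
   again, gives a section [psi] of [p] with values in [D]. *)
have lin_pD : linear (fun x => p (projv D x)) by move=> c x y; rewrite !linearP.
have [|g gK] := linear_surj_section (to_linear lin_pD).
  move=> w; have [d Dd <-] := irreducible_image W irrW ract0 D p Dp D_n0 w.
  by exists d; rewrite /= projv_id.
have lin_psi : linear (fun w => projv D (g w)) by move=> c x y; rewrite !linearP.
pose psi : {linear W -> U} := to_linear lin_psi.
have psiD w : psi w \in D := memv_proj D (g w).
have psiA w : psi w \in A by have [] := DP _ (psiD w).
have ppsi w : p (psi w) = w := gK w.
have psil x w : x ** psi w - psi (x *> w) \in B.
  have [Dx px] := Dp x (psi w) (psiD w).
  by apply: DkerB; [rewrite rpredB | rewrite linearB /= px !ppsi subrr].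
have psi_inj w : psi w \in B -> w = 0.
  by move=> Bw; rewrite -(ppsi w); apply: SB0 => //; case/DP: (psiD w).
have psiAB v w : psi v ** psi w \in B by apply/(subvP sAAB)/memv_lprod.
(* If the right action on A/B is opposite to the left one, A/B yields the symmetric extension, which
   [formation_asym] converts. *)
case: symA => [asymA | symA].
  apply: (@formation_split F FF U (Ideal idB) (asym_module F U W) psi) => //= x m.
  have -> : psi m ** x - psi 0 = psi m ** x by rewrite linear0 subr0.
  exact: asymA.
apply: formation_asym => //.
apply: (@formation_split F FF U (Ideal idB) (sym_module F U W) psi) => //= x m.
change (psi m ** x - psi (- (x *> m)) \in B); rewrite linearN opprK.
rewrite -(subrK (x ** psi m) (psi (x *> m))).
by rewrite addrCA addrC rpredD ?symA // -rpredN opprB.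
Qed.

End Centrality.

(** Describes a factor by a linear map on all of [V] that respects the actions on [S], to avoid
    nested sub- and quotient spaces later. *)
Lemma composition_factor_section {F : fieldType} {L : leibnizType F}
    {V W : lbmodule L} : composition_factor V W ->
  irreducible W /\ exists (S : submodule V) (p : {linear V -> W}),
    (forall w, exists2 v, v \in (S : {vspace V}) & p v = w) /\
    forall x v, v \in (S : {vspace V}) ->
      p (x *> v) = x *> p v /\ p (v <* x) = p v <* x.
Proof.
case=> m [C [i [[_ _ compC] lt_im ->]]].
have [_ irrC] := compC i lt_im; split=> //.
set S := C i.+1; pose T := preim_submodule S (C i).
have lin_p : linear (fun v => vquo T (vsproj S v)) by move=> a u v; rewrite !linearP.
exists S, (to_linear lin_p); split=> [w | x v Sv] /=.
  by exists (vsval (vrepr w)); [exact: subvsP | rewrite vsvalK; apply: vreprK].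
split; rewrite ?quot_lactE ?quot_ractE; congr (vquo T _); apply: val_inj.
  by rewrite /= !vsprojK ?submod_lact.
by rewrite /= !vsprojK ?submod_ract.
Qed.

(** * The faithful module and its hypercentrality *)

Section FaithfulModule.
Context {F : fieldType}.
Variable L : leibnizType F.

Definition faith_lact (x : L) (v : L * F^o) : L * F^o := (x ** v.1, 0).
Definition faith_ract (v : L * F^o) (x : L) : L * F^o := ((v.2 : F) *: x, 0).
Lemma faith_lact_bilinear : bilinear_for *:%R *:%R faith_lact.
Proof.
by split=> [v a x y | x a v w]; congr pair;
  rewrite /= ?linearPl ?linearPr ?scaler0 ?addr0.
Qed.
Lemma faith_ract_bilinear : bilinear_for *:%R *:%R faith_ract.
Proof.
split=> [x a v w | v a x y]; congr pair; rewrite /= ?scaler0 ?addr0 //.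
  by rewrite scalerDl -scalerA.
by rewrite scalerDr !scalerA mulrC.
Qed.
Lemma faith_lactA x y v :
  faith_lact x (faith_lact y v)
  = faith_lact (x ** y) v + faith_lact y (faith_lact x v).
Proof. by congr pair; rewrite /= ?addr0 // lbmulA. Qed.
Lemma faith_lractA x v y :
  faith_lact x (faith_ract v y)
  = faith_ract (faith_lact x v) y + faith_ract v (x ** y).
Proof. by congr pair; rewrite /= ?addr0 // scale0r add0r linearZr. Qed.
Lemma faith_ractA v x y :
  faith_ract v (x ** y)
  = faith_ract (faith_ract v x) y + faith_lact x (faith_ract v y).
Proof. by congr pair; rewrite /= ?addr0 // scale0r add0r linearZr. Qed.
Definition faithful_module : lbmodule L :=
  @LbModule F L (L * F^o)%type faith_lact faith_ract faith_lact_bilinear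
    faith_ract_bilinear faith_lactA faith_lractA faith_ractA.

Lemma faithful_module_hypercentral FF (U : subalgebra L) :
  formation FF -> saturated FF -> (exists K, FF K /\ \dim {:K} <> 0%N) ->
  subnormal U -> FF (subalg_of U) ->
  hypercentral FF (res_module U faithful_module).
Proof.
move=> fFF sFF FFn0 [m [C [C0 Cm _ Cideal]]] FU W.
case/composition_factor_section=> irrW [S [p [p_surj pM]]].
split=> //.
(* In the faithful module (vx)y = 0, since vx has no e-component. *)
have ract0 (w : W) x : w <* x = 0.
  apply: irreducible_ract0 => // {}w {}x y; have [v Sv <-] := p_surj w.
  have [_ <-] := pM x v Sv; have [_ <-] := pM y _ (submod_ract x Sv).
  by rewrite -(linear0 p); congr (p _); congr pair; rewrite /= scale0r.
have [lact0 | lact_inj] := irreducible_lact0 W irrW ract0.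
  exact: central_trivial.
have lin_j : linear (fun u : subalg_of U => (vsval u, 0) : faithful_module).
  by move=> a x y; congr pair; rewrite /= scaler0 addr0.
have lin_pj : linear (fun u : subalg_of U => p (vsval u, 0)).
  by move=> a x y; rewrite -linearP; congr (p _); exact: lin_j.
pose SU : {vspace subalg_of U} := (linfun (to_linear lin_j) @^-1: S)%VS.
have SUP u : (u \in SU) = ((vsval u, 0) \in submod_space S).
  by rewrite -memv_preim lfunE.
apply: (central_section fFF sFF FFn0 irrW ract0 SU (to_linear lin_pj) FU).
  move=> x s; rewrite !SUP => Ss.
  split; first exact: (submod_lact x Ss).
  by have [<- _] := pM x _ Ss.
(* Otherwise [p] vanishes on [S] within [U], and this climbs from [C i] to [C i.+1]: for l in the
   latter and x in [U], the product xl is in [C i], so x kills p l; but no nonzero vector of [W] is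
   killed by all of [U]. *)
apply: NNPP => noS.
have sUC i : (i <= m)%N -> (U <= C i)%VS.
  elim: i => [_ | i IHi lt_im]; first by rewrite C0.
  by apply: subv_trans (IHi (ltnW lt_im)) _; have [] := Cideal i lt_im.
have p0 i (l : L) : (i <= m)%N -> l \in C i ->
    ((l, 0) : faithful_module) \in submod_space S -> p (l, 0) = 0.
  elim: i l => [|i IHi] l le_im Cl Sl.
    apply/eqP; apply: contra_notT noS => pl.
    rewrite C0 in Cl; exists (vsproj U l); last by rewrite /= vsprojK.
    by rewrite SUP vsprojK.
  apply: lact_inj => x; have [<- _] := pM x _ Sl.
  apply: IHi (submod_lact x Sl); first exact: ltnW.
  have [_ idC] := Cideal i le_im.
  by have [] := idC l (vsval x) Cl (subvP (sUC i (ltnW le_im)) _ (subvsP x)).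
(* The same argument passes from [L] to the whole module, since xv has no e-component; then [p]
   vanishes on [S], against surjectivity. *)
have [w w_n0] : exists w : W, w != 0.
  by exists (vpick {:W}); rewrite vpick0; apply/eqP; case: irrW.
have [v Sv vw] := p_surj w; case/eqP: w_n0; apply: lact_inj => x.
rewrite -vw; have [<- _] := pM x _ Sv.
apply: p0 (leqnn m) _ (submod_lact x Sv).
by rewrite Cm memvf.
Qed.

End FaithfulModule.

Theorem theorem4p4 (F : fieldType) (n : nat) (L : leibnizType F)
    (dimL : \dim {:L} = n) :
  exists V : lbmodule L,
    [/\ modker V = 0%VS,
        (\dim {:V} <= n + 1)%N,
        forall x : L, nilpotent_map (fun y : L => x ** y) ->
          nilpotent_map (fun v : V => x *> v),
        forall x : L, nilpotent_map (fun y : L => y ** x) ->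
          nilpotent_map (fun v : V => v <* x)
      & forall FF : leibnizType F -> Prop,
          formation FF -> saturated FF ->
          (* FF is not the class of zero algebras, for which this clause fails *)
          (exists K : leibnizType F, FF K /\ \dim {:K} <> 0%N) ->
          forall U : subalgebra L, subnormal U -> FF (subalg_of U) ->
            hypercentral FF (res_module U V)].
Proof.
exists (faithful_module L); split.
- apply/eqP; rewrite -subv0; apply/subvP=> x /modkerP/(_ (0, 1))[_ [x0]].
  by rewrite memv0 -x0 /= scale1r.
- by rewrite dimvf -dimL dimvf.
(* The first application lands in [L], where the action is left multiplication; hence the exponent
   [k.+1]. *)
- move=> x [k xk]; exists k.+1 => v; rewrite iterSr.
  suff -> : iter k (fun v : faithful_module L => x *> v) (x *> v)
            = (iter k (fun y => x ** y) (x ** v.1), 0) by rewrite xk.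
  by elim: k {xk} => //= k ->.
(* The first right action lands in [L], and the second one gives zero. *)
- by move=> x _; exists 2%N => v; congr pair; rewrite /= scale0r.
- by move=> FF fFF sFF FFn0 U; apply: faithful_module_hypercentral.
Qed.
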